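(* Let $1 \le m \le n$, let $d$ be a positive integer, let $w_1,\dots,w_m \in GF(2)^n$ be linearly independent, and let $G=(V,E)$ be the associated lexigraph. Then the Sprague–Grundy function $g$ of $G$ satisfies $g(u_1 \oplus u_2) = g(u_1) \oplus g(u_2)$ for all $u_1, u_2 \in V$.
   Context: For $k \in \{0,\dots,2^m-1\}$ with binary digits $k^h$, set $A_k = \sum_{h=0}^{m-1} k^h w_{h+1} \in GF(2)^n$. The lexigraph is the digraph $G=(V,E)$ with $V = \{A_0,\dots,A_{2^m-1}\}$ (the span of $w_1,\dots,w_m$) and $(A_k,A_j) \in E$ iff $j<k$ and the Hamming weight of $A_j \oplus A_k$ is less than $d$; it is finite and acyclic. With $F(u)=\{v:(u,v)\in E\}$, the Sprague–Grundy function is the unique $g: V \to \mathbb{Z}_{\ge 0}$ with $g(u) = \operatorname{mex}\{g(v): v \in F(u)\}$, where $\operatorname{mex}(S)$ is the least nonnegative integer not in $S$. On vectors $\oplus$ is addition in $GF(2)^n$; on integers $\oplus$ is the nim-sum (bitwise XOR). *)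

(* Defs.v *)
From HB Require Import structures.
From mathcomp Require Import all_boot all_order all_algebra.

Set Implicit Arguments.
Unset Strict Implicit.
Unset Printing Implicit Defensive.

Import GRing.Theory.
Local Open Scope ring_scope.

Section Mex.
Local Open Scope nat_scope.

Lemma mex_exists (s : seq nat) : exists i, i \notin s.
Proof.
exists (sumn s).+1; apply/negP => si; suff: (sumn s).+1 <= sumn s by rewrite ltnn.
move: (_.+1) si => i; elim: s => //= x s IHs; rewrite inE => /orP[/eqP-> | /IHs].
  exact: leq_addr.
by move=> le_i; apply: leq_trans le_i (leq_addl _ _).
Qed.

Definition mex (s : seq nat) : nat := ex_minn (mex_exists s).

End Mex.

(* [E u v] means that (u, v) is an edge; [E] is understood to hold only between
   elements of [V], and the values of [g] outside [V] are irrelevant. *)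
Definition sprague_grundy (T : finType) (V : {set T}) (E : rel T)
    (g : T -> nat) : Prop :=
  {in V, forall u, g u = mex [seq g v | v in [set v | E u v]]}.

Section SpragueGrundyTheory.
Local Open Scope nat_scope.
Variables (T : finType) (V : {set T}) (E : rel T) (r : T -> nat).
Hypothesis EV : forall u v, E u v -> v \in V.
Hypothesis Er : forall u v, E u v -> r v < r u.

Lemma sprague_grundy_exists : exists g, sprague_grundy V E g.
Proof.
pose f := fix f k u := if k is k'.+1 then
  mex [seq f k' v | v in [set v | E u v]] else 0.
have fE k l u : r u < k -> r u < l -> f k u = f l u.
  elim: k l u => // k IHk [|l] u //= uk ul; congr mex.
  apply/eq_in_map => v; rewrite mem_enum inE => /Er vu.
  by apply: IHk; apply: leq_trans vu _.
exists (fun u => f (r u).+1 u) => u _ /=; congr mex.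
by apply/eq_in_map => v; rewrite mem_enum inE => /Er vu;
  exact: (fE (r u) (r v).+1 v vu (ltnSn _)).
Qed.

Lemma sprague_grundy_unique g h :
  sprague_grundy V E g -> sprague_grundy V E h -> {in V, g =1 h}.
Proof.
move=> gP hP u; elim: (r u).+1 {-2}u (ltnSn (r u)) => // k IHk {}u uk uV.
rewrite gP // hP //; congr mex; apply/eq_in_map => v.
rewrite mem_enum inE => Euv; apply: IHk (EV Euv).
exact: leq_trans (Er Euv) _.
Qed.

End SpragueGrundyTheory.

Section Lexigraph.
Variables (n m d : nat) (w : 'I_m -> 'rV['F_2]_n).

Definition hamming_weight (x : 'rV['F_2]_n) : nat := #|[set i | x 0 i != 0]|.

(* [odd (k %/ 2 ^ h)] is the coefficient of 2 ^ h in the binary expansion of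
   [k]; the indices of [w] start at 0, so the digit of 2 ^ h goes with [w h]. *)
Definition lexivec (k : nat) : 'rV['F_2]_n :=
  \sum_(h < m) (odd (k %/ 2 ^ h) : nat)%:R *: w h.

Definition lexi_vertices : {set 'rV['F_2]_n} :=
  [set lexivec k | k : 'I_(2 ^ m)].

Definition lexi_edge : rel 'rV['F_2]_n := fun u v =>
  [exists k : 'I_(2 ^ m), exists j : 'I_(2 ^ m),
    [&& u == lexivec k, v == lexivec j, (j < k)%N
      & (hamming_weight (lexivec j + lexivec k)%R < d)%N]].

Hypothesis w_free : free [seq w h | h : 'I_m].

Lemma lexivec_inj (k j : 'I_(2 ^ m)) : lexivec k = lexivec j -> k = j.
Proof.
move=> kj; have digits (h : 'I_m) : odd (k %/ 2 ^ h) = odd (j %/ 2 ^ h).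
  have w_freeT : free [tuple w h | h < m] by [].
  pose c (i : 'I_m) : 'F_2 := (odd (k %/ 2 ^ i))%:R - (odd (j %/ 2 ^ i))%:R.
  have /(freeP w_freeT)/(_ h) : \sum_(i < m) c i *: [tuple w h | h < m]`_i = 0.
    transitivity (lexivec k - lexivec j); last by rewrite kj subrr.
    rewrite /lexivec -sumrB; apply: eq_bigr => i _.
    by rewrite -tnth_nth tnth_mktuple scalerBl.
  by rewrite /c; case: odd; case: odd.
apply: val_inj; case: k j {kj} digits => [k km] [j jm] /= digits.
elim: m k j km jm digits => [|p IHp] k j kp jp digits.
  by move: k j kp jp {digits} => [|k] [|j].
have half_lt i : (i < 2 ^ p.+1)%N -> (i./2 < 2 ^ p)%N.
  by rewrite expnS mul2n -divn2 ltn_divLR // muln2.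
have /= := digits ord0; rewrite !divn1 => odd_kj.
rewrite -(odd_double_half k) -(odd_double_half j) odd_kj.
congr (_ + _.*2)%N; apply: IHp; rewrite ?half_lt // => h.
by have := digits (lift ord0 h); rewrite lift0 !expnS !divnMA !divn2.
Qed.

Lemma lexi_edge_ranked :
  exists r : 'rV['F_2]_n -> nat, forall u v, lexi_edge u v -> (r v < r u)%N.
Proof.
pose r u := (\sum_(k < 2 ^ m | lexivec k == u) k)%N.
have rE (k : 'I_(2 ^ m)) : r (lexivec k) = k.
  rewrite /r (big_pred1 k) // => j; apply/eqP/eqP => [/lexivec_inj // | -> //].
exists r => u v.
by case/existsP=> k /existsP[j /and4P[/eqP-> /eqP->]]; rewrite !rE.
Qed.

Lemma lexi_sprague_grundy_exists :
  exists g, sprague_grundy lexi_vertices lexi_edge g.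
Proof. by have [r rP] := lexi_edge_ranked; apply: sprague_grundy_exists rP. Qed.

Lemma lexi_sprague_grundy_unique g h :
    sprague_grundy lexi_vertices lexi_edge g ->
    sprague_grundy lexi_vertices lexi_edge h ->
  {in lexi_vertices, g =1 h}.
Proof.
have [r rP] := lexi_edge_ranked; apply: (sprague_grundy_unique _ rP) => u v.
by case/existsP=> k /existsP[j /and4P[_ /eqP-> _ _]]; apply: imset_f.
Qed.

End Lexigraph.

(* Main.v *)
Require Import Defs.
From Stdlib Require PeanoNat.
From mathcomp Require Import all_boot all_order all_algebra.

Set Implicit Arguments.
Unset Strict Implicit.

Import GRing.Theory.
Local Open Scope ring_scope.

(** The Grundy value of [A_k] is the least one not taken by the [A_j], [j < k],
    with [A_j + A_k] in the fixed set [S] of vectors of weight [< d]; only the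
    translation invariance of this condition matters. Suppose [g] is additive
    on the [A_a] with [a < 2 ^ i], and write [c = 2 ^ i]. Then
    [A_(c + a) = A_c + A_a], and the options of [A_(c + a)] are the translates
    by [A_a] of the options of [A_c] together with the translates by [A_c] of
    the options of [A_a]: the position behaves like the disjunctive sum of
    [A_c] and [A_a], and the nim-sum argument of Sprague and Grundy gives
    [g (A_c + A_a) = g A_c (+) g A_a], which extends additivity to
    indices below [2 ^ i.+1]. *)

(** * Nim-sums and mex on natural numbers *)

Lemma odd_lxor (a b : nat) : odd (Nat.lxor a b) = odd a (+) odd b.
Proof.
have oddE k : odd k = Nat.testbit k 0.
  by rewrite /= /Nat.odd; elim: k {-2}k (leqnn k) => [|l IHl] [|[|k]] //= kl;
    rewrite negbK IHl // -ltnS ltnW.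
by rewrite !oddE PeanoNat.Nat.lxor_spec; do 2 case: Nat.testbit.
Qed.

Lemma half_lxor (a b : nat) : (Nat.lxor a b)./2 = Nat.lxor a./2 b./2.
Proof.
have halfE k : k./2 = Nat.div2 k.
  elim: k {-2}k (leqnn k) => [|l IHl] [|[|k]] //= kl.
  by rewrite IHl // -ltnS ltnW.
apply: PeanoNat.Nat.bits_inj => i.
by rewrite PeanoNat.Nat.lxor_spec !halfE !PeanoNat.Nat.testbit_div2
  PeanoNat.Nat.lxor_spec.
Qed.

Lemma ltn_halfE (a b : nat) :
  (a < b)%N = (a./2 < b./2)%N || [&& a./2 == b./2, ~~ odd a & odd b].
Proof.
rewrite -{1}(odd_double_half a) -{1}(odd_double_half b).
case: (ltngtP a./2 b./2) => [lt_ab|lt_ba|->] /=; last first.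
- by rewrite ltn_add2r; case: odd; case: odd.
- apply/negbTE; rewrite -leqNgt; apply: (@leq_trans (b./2.+1.*2)).
    by rewrite doubleS -add2n leq_add2r; case: odd.
  by apply: leq_trans (leq_addl _ _); rewrite leq_double.
- apply: (@leq_trans (a./2.+1.*2)).
    by rewrite doubleS -addSn -add2n leq_add2r; case: odd.
  by apply: leq_trans (leq_addl _ _); rewrite leq_double.
Qed.

Lemma lxorK (a b : nat) : Nat.lxor (Nat.lxor a b) b = a.
Proof.
by rewrite PeanoNat.Nat.lxor_assoc PeanoNat.Nat.lxor_nilpotent
  PeanoNat.Nat.lxor_0_r.
Qed.

Lemma lxorKl (a b : nat) : Nat.lxor a (Nat.lxor a b) = b.
Proof. by rewrite PeanoNat.Nat.lxor_comm (PeanoNat.Nat.lxor_comm a) lxorK. Qed.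

(** At the highest bit where [y] and the nim-sum differ, [y] has 0 and exactly one of [a], [b] has
    1; nim-adding [y] to the other one clears that bit and keeps the higher bits. The proof reads
    this off by halving. *)
Lemma ltn_lxor (y a b : nat) : (y < Nat.lxor a b)%N ->
  (Nat.lxor y b < a)%N \/ (Nat.lxor y a < b)%N.
Proof.
elim: y.+1 {-2}y (ltnSn y) a b => // l IHl {}y yl a b.
(* Halving does not decrease 0, so this case is settled apart. *)
have [->|y_gt0] := posnP y.
  rewrite !PeanoNat.Nat.lxor_0_l => ab; case: (ltngtP a b); auto => eq_ab.
  by rewrite eq_ab PeanoNat.Nat.lxor_nilpotent in ab.
have half_lt : (y./2 < l)%N.
  rewrite ltnS in yl; apply: leq_trans yl.
  by rewrite ltn_half_double -addnn -{1}[y]addn0 ltn_add2l.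
rewrite !(ltn_halfE (Nat.lxor _ _)) (ltn_halfE y) !half_lxor !odd_lxor.
case/orP => [/(IHl _ half_lt)[] ->|]; [by left | by right |].
case/and3P => /eqP -> /negbTE-> /=; rewrite lxorK.
rewrite (PeanoNat.Nat.lxor_comm a./2) lxorK !eqxx /=.
by case: (odd a); case: (odd b) => //= _; rewrite ?orbT; [left | right].
Qed.

Lemma mex_notin (s : seq nat) : mex s \notin s.
Proof. by rewrite /mex; case: ex_minnP. Qed.

Lemma lt_mex_in (s : seq nat) (y : nat) : (y < mex s)%N -> y \in s.
Proof.
rewrite /mex; case: ex_minnP => i _ min_i; rewrite ltnNge.
by apply: contraNT => /min_i.
Qed.

(** * Additivity of greedy labels in a group of exponent 2 *)

Section GreedyAdditive.

Variables (V : zmodType) (S : pred V) (A : nat -> V) (g : V -> nat) (m : nat).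

Hypothesis addvv : forall x : V, x + x = 0.
Hypothesis A0 : A 0 = 0.
Hypothesis A_add : forall i a : nat, (i < m)%N -> (a < 2 ^ i)%N ->
  A (2 ^ i + a)%N = A (2 ^ i)%N + A a.
(** With [g_least], this is the mex rule stated on indices. *)
Hypothesis g_neq : forall k j : nat, (k < 2 ^ m)%N -> (j < k)%N ->
  S (A j + A k) -> g (A j) <> g (A k).
Hypothesis g_least : forall k y : nat, (k < 2 ^ m)%N -> (y < g (A k))%N ->
  exists j : nat, [/\ (j < k)%N, S (A j + A k) & g (A j) = y].

Lemma grundy_value (k x : nat) : (k < 2 ^ m)%N ->
    (forall j : nat, (j < k)%N -> S (A j + A k) -> g (A j) <> x) ->
    (forall y : nat, (y < x)%N ->
       exists j : nat, [/\ (j < k)%N, S (A j + A k) & g (A j) = y]) ->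
  g (A k) = x.
Proof.
move=> km x_neq x_least; case: (ltngtP (g (A k)) x) => //.
  by move=> /x_least[j [jk /(g_neq km jk)]].
by move=> /(g_least km)[j [jk /(x_neq j jk)]].
Qed.

Lemma grundy0 : g 0 = 0%N.
Proof. by rewrite -A0; apply: grundy_value; rewrite ?expn_gt0. Qed.

(** Translation invariance of the option condition. *)
Lemma addvACA (x y z : V) : (x + y) + (x + z) = y + z.
Proof. by rewrite addrACA addvv add0r. Qed.

Lemma split_index (i k : nat) : (k < 2 ^ i.+1)%N ->
  (k < 2 ^ i)%N \/ exists2 a, (a < 2 ^ i)%N & k = (2 ^ i + a)%N.
Proof.
rewrite expnS mul2n -addnn; case: (ltnP k (2 ^ i)) => [|le_k lt_k]; first by left.
by right; exists (k - 2 ^ i)%N; rewrite ?subnKC // ltn_subLR.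
Qed.

(** The first [2 ^ i] vectors form a subgroup: by induction, the leading vectors either cancel or
    leave a single one. *)
Lemma index_add (i : nat) : (i <= m)%N ->
  forall a b : nat, (a < 2 ^ i)%N -> (b < 2 ^ i)%N ->
  exists2 c, (c < 2 ^ i)%N & A a + A b = A c.
Proof.
elim: i => [|i IHi] im a b.
  by rewrite !ltnS !leqn0 => /eqP-> /eqP->; exists 0%N; rewrite // A0 addr0.
have lt2 c : (c < 2 ^ i)%N -> (c < 2 ^ i.+1)%N /\ (2 ^ i + c < 2 ^ i.+1)%N.
  by move=> ci; rewrite expnS mul2n -addnn ltn_add2l ltn_addr.
have {}IHi := IHi (ltnW im).
case/split_index => [ai|[{}a ai ->]] /split_index[bi|[{}b bi ->]];
  have [c ci abc] := IHi _ _ ai bi; have [c1 c2] := lt2 c ci.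
- by exists c.
- by exists (2 ^ i + c)%N; rewrite // !A_add // addrCA abc.
- by exists (2 ^ i + c)%N; rewrite // !A_add // -addrA abc.
- by exists c; rewrite // !A_add // addvACA.
Qed.

Lemma grundy_split (i : nat) : (i < m)%N ->
    (forall a b : nat, (a < 2 ^ i)%N -> (b < 2 ^ i)%N ->
       g (A a + A b) = Nat.lxor (g (A a)) (g (A b))) ->
  forall a : nat, (a < 2 ^ i)%N ->
    g (A (2 ^ i + a)%N) = Nat.lxor (g (A (2 ^ i)%N)) (g (A a)).
Proof.
move=> im g_add; have cm : (2 ^ i < 2 ^ m)%N by rewrite ltn_exp2l.
have cam b : (b < 2 ^ i)%N -> (2 ^ i + b < 2 ^ m)%N.
  move=> bi; apply: (@leq_trans (2 ^ i.+1)); last by rewrite leq_exp2l.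
  by rewrite expnS mul2n -addnn ltn_add2l.
move=> a; elim: a {-2}a (leqnn a) => [|k IHk] a ak ai.
  move: ak; rewrite leqn0 => /eqP->.
  by rewrite addn0 A0 grundy0 PeanoNat.Nat.lxor_0_r.
have {}IHk b : (b < a)%N ->
    g (A (2 ^ i + b)%N) = Nat.lxor (g (A (2 ^ i)%N)) (g (A b)).
  move=> ba; apply: IHk; last exact: ltn_trans ba ai.
  by rewrite -ltnS (leq_trans ba).
apply: grundy_value; first exact: cam.
  move=> j jca; have [ji|[b bi def_j]] : (j < 2 ^ i)%N \/
      exists2 b, (b < 2 ^ i)%N & j = (2 ^ i + b)%N.
  - apply: split_index; apply: ltn_trans jca _.
    by rewrite expnS mul2n -addnn ltn_add2l.
  (* Translating by [A a] turns this option into the option [A l] of [A (2 ^ i)]. *)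
  - have [l li jal] := index_add (ltnW im) ji ai.
    rewrite A_add // addrCA addrC jal => /(g_neq cm li) + gj; apply.
    by rewrite -jal g_add // gj lxorK.
  (* Here the translation by [A (2 ^ i)] gives the option [A b] of [A a], and the induction on [a]
     applies to [b]. *)
  rewrite {}def_j ltn_add2l in jca *; rewrite !A_add // addvACA -A_add //.
  move=> /(g_neq (ltn_trans ai cm) jca) + gj; apply.
  by rewrite IHk // in gj; rewrite -(lxorKl (g (A (2 ^ i)%N)) (g (A b))) gj lxorKl.
move=> y /ltn_lxor[/(g_least cm)[l [li Sl gl]]|].
  (* The value [y] is reached by moving in the summand [A (2 ^ i)] to [A l], that is, to
     [A l + A a]. *)
  have [j ji laj] := index_add (ltnW im) li ai.
  exists j; split; first exact: ltn_addr.
    by rewrite A_add // -laj (addrC (A (2 ^ i)%N)) (addrC (A l)) addvACA.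
  by rewrite -laj g_add // gl lxorK.
(* Otherwise the move is made in the summand [A a]. *)
move=> /(g_least (ltn_trans ai cm))[b [ba Sb gb]].
have bi := ltn_trans ba ai.
exists (2 ^ i + b)%N; split; first by rewrite ltn_add2l.
  by rewrite !A_add // addvACA.
by rewrite IHk // gb PeanoNat.Nat.lxor_comm lxorK.
Qed.

Lemma grundy_additive (i : nat) : (i <= m)%N ->
  forall a b : nat, (a < 2 ^ i)%N -> (b < 2 ^ i)%N ->
  g (A a + A b) = Nat.lxor (g (A a)) (g (A b)).
Proof.
elim: i => [|i IHi] im a b.
  rewrite !ltnS !leqn0 => /eqP-> /eqP->.
  by rewrite PeanoNat.Nat.lxor_nilpotent A0 addr0 grundy0.
have {}IHi := IHi (ltnW im); have g_split := @grundy_split i im IHi.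
case/split_index => [ai|[{}a ai ->]] /split_index[bi|[{}b bi ->]].
- exact: IHi.
- have [c ci abc] := index_add (ltnW im) ai bi.
  rewrite A_add // addrCA abc -!A_add // !g_split // -abc IHi //.
  rewrite -!PeanoNat.Nat.lxor_assoc.
  by rewrite (PeanoNat.Nat.lxor_comm (g (A a))).
- have [c ci abc] := index_add (ltnW im) ai bi.
  rewrite A_add // -addrA abc -!A_add // !g_split // -abc IHi //.
  by rewrite -!PeanoNat.Nat.lxor_assoc.
- rewrite !A_add // addvACA -!A_add // !g_split // IHi //.
  rewrite (PeanoNat.Nat.lxor_comm _ (g (A a))) PeanoNat.Nat.lxor_assoc.
  by rewrite lxorKl.
Qed.

End GreedyAdditive.

(** * Application to the lexigraph *)

Lemma lexivec0 (n m : nat) (w : 'I_m -> 'rV['F_2]_n) : lexivec w 0 = 0.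
Proof. by rewrite /lexivec big1 // => h _; rewrite div0n scale0r. Qed.

(** Since [a < 2 ^ i], the sum of indices has no carry, so the digits add separately; the cases
    compare [h] with [i]. *)
Lemma lexivec_add (n m : nat) (w : 'I_m -> 'rV['F_2]_n) (i a : nat) :
  (a < 2 ^ i)%N -> lexivec w (2 ^ i + a) = lexivec w (2 ^ i) + lexivec w a.
Proof.
move=> ai; rewrite /lexivec -big_split /=; apply: eq_bigr => h _.
rewrite -scalerDl; congr (_ *: _).
have [hi|ih] := leqP i h.
  have -> : (a %/ 2 ^ h = 0)%N.
    by rewrite divn_small // (leq_trans ai) // leq_exp2l.
  rewrite addr0; move: hi; rewrite leq_eqVlt => /orP[/eqP <-|hi].
    by rewrite divnDl // divnn expn_gt0 /= divn_small.
  rewrite !divn_small ?ltn_exp2l //; apply: (@leq_trans (2 ^ i.+1)).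
    by rewrite expnS mul2n -addnn ltn_add2l.
  by rewrite leq_exp2l.
have def2i : (2 ^ i = 2 ^ (i - h) * 2 ^ h)%N by rewrite -expnD subnK // ltnW.
rewrite divnDl def2i ?dvdn_mull // mulnK ?expn_gt0 // oddD oddX subn_eq0.
by rewrite leqNgt ih add0r.
Qed.

(** Freeness makes the index of a vertex unique, so the source index quantified in [lexi_edge] must
    be [k]. *)
Lemma lexi_edgeP (n m d : nat) (w : 'I_m -> 'rV['F_2]_n) (k : nat)
    (v : 'rV['F_2]_n) :
  free [seq w h | h : 'I_m] -> (k < 2 ^ m)%N ->
  reflect (exists j : nat, [/\ (j < k)%N,
             (hamming_weight (lexivec w j + lexivec w k) < d)%N
             & v = lexivec w j])
          (lexi_edge d w (lexivec w k) v).
Proof.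
move=> w_free km; apply: (iffP existsP).
  case=> k' /existsP[j /and4P[/eqP kk' /eqP-> jk wt_jk]].
  have /(congr1 val)/= def_k := @lexivec_inj n m w w_free (Ordinal km) k' kk'.
  by rewrite -def_k in jk wt_jk; exists j.
case=> j [jk wt_jk ->]; exists (Ordinal km); apply/existsP.
by exists (Ordinal (ltn_trans jk km)); rewrite /= !eqxx jk wt_jk.
Qed.

Theorem theorem1 (n m d : nat) (w : 'I_m -> 'rV['F_2]_n)
    (g : 'rV['F_2]_n -> nat) :
  (1 <= m)%N -> (m <= n)%N -> (0 < d)%N ->
  free [seq w h | h : 'I_m] ->
  sprague_grundy (lexi_vertices w) (lexi_edge d w) g ->
  {in lexi_vertices w &, forall u1 u2,
    g (u1 + u2) = Nat.lxor (g u1) (g u2)}.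
Proof.
move=> _ _ _ w_free gP _ _ /imsetP[a _ ->] /imsetP[b _ ->].
have {}gP k : (k < 2 ^ m)%N -> g (lexivec w k) =
    mex [seq g v | v in [set v | lexi_edge d w (lexivec w k) v]].
  by move=> km; apply: gP; apply/imsetP; exists (Ordinal km).
(* At level [i = m] the indices exhaust all vertices. *)
apply: (@grundy_additive _ (fun x => hamming_weight x < d)%N _ _ m _ _ _ _ _ m)
  => //.
- by move=> x; apply/rowP => i; rewrite !mxE addrr_pchar2 // pchar_Fp.
- exact: lexivec0.
- by move=> i c _; apply: lexivec_add.
- move=> k j km jk wt_jk gjk; move: (gP k km) => gk.
  have /negP := mex_notin [seq g v | v in [set v | lexi_edge d w (lexivec w k) v]].
  apply; rewrite -gk -gjk; apply: image_f; rewrite inE.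
  by apply/lexi_edgeP => //; exists j.
- move=> k y km; rewrite gP // => /lt_mex_in/imageP[v].
  by rewrite inE => /lexi_edgeP-/(_ w_free km)[j [jk wt_jk ->]] ->; exists j.
Qed.
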